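(* For every first-order formula $\varphi(x,\bar y)$ in the language of graphs with a single object variable $x$, there are finitely many polynomials $p_1(t_1,t_2),\dots,p_{k}(t_1,t_2)\in\mathbb{Z}[t_1,t_2]$ and parameter-free formulas $\psi_1(\bar y),\dots,\psi_{k}(\bar y)$ in the language of graphs such that the following holds. Whenever $\{H_n:n<\omega\}$ is a class of finite graphs with each $H_n$ being $d(n)$-regular, $d(n)\to\infty$ and $\operatorname{girth}(H_n)\to\infty$, $\mathcal{U}$ is a non-principal ultrafilter on $\omega$, $\mathcal{M}=\prod_{\mathcal{U}}H_n$, $\alpha=[\,|H_n|\,]_{\mathcal{U}}$ and $\beta=[d(n)]_{\mathcal{U}}$, we have: (1) the sets $\psi_1(\mathcal{M}^{|\bar y|}),\dots,\psi_k(\mathcal{M}^{|\bar y|})$ form a partition of $\mathcal{M}^{|\bar y|}$; (2) for every $\bar a\in\mathcal{M}^{|\bar y|}$ and every $i\leq k$, $\mathcal{M}\models\psi_i(\bar a)$ if and only if $|\varphi(\mathcal{M},\bar a)|=p_i(\alpha,\beta)$.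
   Context: Graphs are simple; $\operatorname{girth}(H)$ is the length of a shortest cycle in $H$. For a definable set $X=\varphi(\mathcal{M}^n,\bar a)$ with $\bar a=[\bar a_k]_{\mathcal{U}}$, its non-standard cardinality is $|X|=[\,|\varphi(H_k^n,\bar a_k)|\,]_{\mathcal{U}}\in\mathbb{R}^{\mathcal{U}}$; polynomials are evaluated in $\mathbb{R}^{\mathcal{U}}$. *)

(* Defs.v *)
From HB Require Import structures.
From mathcomp Require Import all_boot all_order all_algebra.
From mathcomp Require Import boolp.
From mathcomp Require Import mpoly.

Set Implicit Arguments.
Unset Strict Implicit.
Unset Printing Implicit Defensive.

Import GRing.Theory.

Record fingraph := FinGraph {
  vert : finType;
  adj : rel vert;
  adj_sym : ssrbool.symmetric adj;
  adj_irr : ssrbool.irreflexive adj }.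

Definition regular (G : fingraph) (d : nat) : Prop :=
  forall v : vert G, #|[set w | adj v w]| = d.

Definition has_cycle_of_length (G : fingraph) (l : nat) : Prop :=
  exists s : seq (vert G), [/\ size s = l, (3 <= l)%N, uniq s & cycle (@adj G) s].

(* girth(G) >= L  (girth = length of a shortest cycle, +oo if acyclic) *)
Definition girth_ge (G : fingraph) (L : nat) : Prop :=
  forall l, has_cycle_of_length G l -> (L <= l)%N.

Definition tends_to_infty (d : nat -> nat) : Prop :=
  forall L, exists N, forall n, (N <= n)%N -> (L <= d n)%N.

Definition girth_tends_to_infty (H : nat -> fingraph) : Prop :=
  forall L, exists N, forall n, (N <= n)%N -> girth_ge (H n) L.

Definition ultrafilter (U : (nat -> Prop) -> Prop) : Prop :=
  [/\ U (fun _ => True),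
      ~ U (fun _ => False),
      (forall A B : nat -> Prop, U A -> (forall n, A n -> B n) -> U B),
      (forall A B : nat -> Prop, U A -> U B -> U (fun n => A n /\ B n))
    & (forall A : nat -> Prop, U A \/ U (fun n => ~ A n))].

Definition nonprincipal_ultrafilter (U : (nat -> Prop) -> Prop) : Prop :=
  ultrafilter U /\ forall k : nat, ~ U (fun n => n = k).

Inductive formula : Type :=
  | FAdj of nat & nat
  | FEq of nat & nat
  | FNeg of formula
  | FAnd of formula & formula
  | FOr of formula & formula
  | FEx of nat & formula
  | FAll of nat & formula.

Fixpoint free_in (P : nat -> bool) (f : formula) : bool :=
  match f with
  | FAdj i j | FEq i j => P i && P j
  | FNeg g => free_in P g
  | FAnd g h | FOr g h => free_in P g && free_in P h
  | FEx i g | FAll i g => free_in (fun v => (v == i) || P v) g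
  end.

(* Tarski semantics in a structure (T, eqT, E) where eqT interprets the
   equality symbol and E the edge symbol; environments are partial
   (variables outside the scope are unassigned; well-scoped formulas never
   look at them). *)
Definition upd (T : Type) (env : nat -> option T) (i : nat) (a : T) :=
  fun v => if v == i then Some a else env v.

Section Sat.
Variables (T : Type) (eqT E : T -> T -> Prop).
Fixpoint sat (env : nat -> option T) (f : formula) : Prop :=
  match f with
  | FAdj i j => match env i, env j with Some a, Some b => E a b | _, _ => False end
  | FEq i j => match env i, env j with Some a, Some b => eqT a b | _, _ => False end
  | FNeg g => ~ sat env g
  | FAnd g h => sat env g /\ sat env h
  | FOr g h => sat env g \/ sat env h
  | FEx i g => exists a : T, sat (upd env i a) g
  | FAll i g => forall a : T, sat (upd env i a) g
  end.
End Sat.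

(* environment: v_0 |-> x (the object variable), v_{j+1} |-> a_j (parameters y) *)
Definition tup_env (T : Type) (m : nat) (x : option T) (a : 'I_m -> T) : nat -> option T :=
  fun v => match v with 0 => x | j.+1 => omap a (insub j) end.

Definition gsat (G : fingraph) (env : nat -> option (vert G)) (f : formula) : Prop :=
  sat (@eq (vert G)) (fun a b => adj a b) env f.

(* Ultraproduct M = prod_U H_n, presented as the product of the H_n   *)
(* with equality interpreted as U-a.e. equality (the usual quotient   *)
(* construction, with the quotient left implicit).                   *)
Definition uprod_carrier (H : nat -> fingraph) := forall n, vert (H n).

Definition usat (H : nat -> fingraph) (U : (nat -> Prop) -> Prop)
    (env : nat -> option (uprod_carrier H)) (f : formula) : Prop :=
  sat (fun a b : uprod_carrier H => U (fun n => a n = b n))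
      (fun a b : uprod_carrier H => U (fun n => adj (a n) (b n))) env f.

Definition count_def (G : fingraph) (m : nat) (phi : formula) (a : 'I_m -> vert G) : nat :=
  #|[set x : vert G | `[< gsat (tup_env (Some x) a) phi >] ]|.

Definition eval2 (p : {mpoly int[2]}) (t1 t2 : int) : int :=
  p.@[fun i : 'I_2 => if (i : nat) == 0%N then t1 else t2].

(* Main.v *)
Require Import Defs.
From HB Require Import structures.
From mathcomp Require Import all_boot all_order all_algebra.
From mathcomp Require Import boolp.
From mathcomp Require Import mpoly.
From mathcomp Require Import zify.

(** By Los' theorem it suffices to work, uniformly, in finite q-regular graphs G of
    large girth and large degree q.  Such a graph looks like a tree at bounded
    distances, so the cardinality of an intersection of balls of bounded radius is
    a polynomial in q depending only on the radii and on the truncated distances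
    between the centres; by inclusion-exclusion, the number of x with prescribed
    truncated distances to a tuple a is a polynomial in (|G|, q) depending only on
    the truncated distance matrix of a (its type).  Large girth forces |G| to exceed
    any fixed power of q, so a nonzero polynomial does not vanish at (|G|, q);
    hence [exists x, phi] holds exactly when the polynomial counting phi is nonzero.
    Inductively, every formula is a property of types, and its number of solutions
    in x is a polynomial given by the type of the parameters.  Each psi_i is the
    disjunction of the types that yield the polynomial p_i. *)

Set Implicit Arguments.
Unset Strict Implicit.
Unset Printing Implicit Defensive.

Import GRing.Theory.

(** * Truncated distance and local tree structure *)

Section Distance.
Variable G : fingraph.
Implicit Types a b c x y z : vert G.

(** A step may stay put, so the relation is monotone in [r] and bounds the distance by [r]. *)
Fixpoint within r a b : bool :=
  if r is r'.+1 then [exists c, ((c == a) || adj c a) && within r' c b]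
  else a == b.

(* min(N, distance); in particular N between distinct components. *)
Definition tdist N a b := find (fun r => within r a b) (iota 0 N).

Lemma within_refl r a : within r a a.
Proof.
elim: r => [|r IH] /=; first exact: eqxx.
by apply/existsP; exists a; rewrite eqxx IH.
Qed.

Lemma within_trans r s a b c :
  within r a b -> within s b c -> within (r + s) a c.
Proof.
elim: r a => [|r IH] a /=; first by move/eqP->.
case/existsP=> e /andP[he hb] hc; apply/existsP; exists e.
by rewrite he IH.
Qed.

Lemma within_leq r s a b : r <= s -> within r a b -> within s a b.
Proof.
by move=> /subnKC<- h; apply: within_trans h (within_refl _ _).
Qed.

Lemma within1 a b : within 1 a b = (b == a) || adj a b.
Proof.
apply/existsP/idP => [[c /andP[h /eqP<-]]|h]; first by rewrite adj_sym.
by exists b; rewrite adj_sym h eqxx.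
Qed.

Lemma withinC r a b : within r a b = within r b a.
Proof.
wlog suff: a b / within r a b -> within r b a.
  by move=> h; apply/idP/idP; apply: h.
elim: r a => [|r IH] a /=; first by rewrite eq_sym.
case/existsP=> c /andP[h /IH hb].
change (within r.+1 b a); rewrite -addn1; apply: within_trans hb _.
by rewrite within1 eq_sym.
Qed.

Lemma tdist_leN N a b : tdist N a b <= N.
Proof. by rewrite -[leqRHS](size_iota 0) find_size. Qed.

Lemma within_tdist N s a b : s < N -> within s a b = (tdist N a b <= s).
Proof.
move=> ltsN; apply/idP/idP => [h|].
  rewrite leqNgt; apply/negP => /(before_find 0).
  by rewrite nth_iota // h.
move=> h; apply: (within_leq h).
have hf : has (fun r => within r a b) (iota 0 N).
  by rewrite has_find size_iota; apply: leq_ltn_trans h ltsN.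
have := nth_find 0 hf; rewrite nth_iota //.
by apply: leq_ltn_trans h ltsN.
Qed.

Lemma tdistP N a b t : t <= N ->
  reflect (forall s, s < N -> within s a b = (t <= s)) (tdist N a b == t).
Proof.
move=> letN; apply: (iffP eqP) => [<- s|h]; first exact: within_tdist.
have [lt|gt|//] := ltngtP (tdist N a b) t.
  have ltN := leq_trans lt letN.
  by have := h _ ltN; rewrite (within_tdist _ _ ltN); lia.
have ltN : t < N by apply: leq_trans gt (tdist_leN _ _ _).
by have := h _ ltN; rewrite (within_tdist _ _ ltN); lia.
Qed.

Lemma tdist_minn M N a b : M <= N -> tdist M a b = minn M (tdist N a b).
Proof.
move=> leMN; apply/eqP/tdistP; first exact: geq_minl.
move=> s ltsM; rewrite (within_tdist a b (leq_trans ltsM leMN)); lia.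
Qed.

Lemma tdistC N a b : tdist N a b = tdist N b a.
Proof. by apply: eq_find => r; rewrite withinC. Qed.

Lemma tdist_triangle N b a c : tdist N a c <= tdist N a b + tdist N b c.
Proof.
have [lt|] := ltnP (tdist N a b + tdist N b c) N; last first.
  exact: leq_trans (tdist_leN _ _ _).
rewrite -within_tdist //; apply: within_trans; rewrite (within_tdist (N := N)) //; lia.
Qed.

Lemma tdist_eq0 N a b : 0 < N -> (tdist N a b == 0) = (a == b).
Proof. by move=> N0; rewrite -leqn0 -within_tdist. Qed.

Lemma tdistxx N a : tdist N a a = 0.
Proof.
case: N => [|N]; first by apply/eqP; rewrite -leqn0 tdist_leN.
by apply/eqP; rewrite tdist_eq0.
Qed.

Lemma tdist_adj N a b : adj a b -> tdist N a b <= 1.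
Proof.
case: (ltnP 1 N) => [N1 h|]; last by move=> + _; apply: leq_trans (tdist_leN _ _ _).
by rewrite -within_tdist // within1 h orbT.
Qed.

Lemma tdist_eq1 N a b : 1 < N -> (tdist N a b == 1) = adj a b.
Proof.
move=> N1.
have := within_tdist a b N1; rewrite within1.
have := tdist_eq0 a b (ltnW N1).
have [->|ne] := eqVneq a b; first by rewrite adj_irr => /eqP->.
by rewrite /=; lia.
Qed.

Lemma tdist_adj_le N a b c : adj a b -> tdist N b c <= (tdist N a c).+1.
Proof.
move=> h; apply: leq_trans (tdist_triangle _ a _ _) _.
by rewrite -[leqRHS]add1n leq_add2r tdistC tdist_adj.
Qed.

Lemma tdist_descent N a b l : tdist N a b = l.+1 -> l.+1 < N ->
  exists2 c, adj a c & tdist N c b = l.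
Proof.
move=> dl ltN; have: within l.+1 a b by rewrite (within_tdist _ _ ltN) dl.
rewrite /= => /existsP[c /andP[hc]].
rewrite (within_tdist (N := N)); last by lia.
move=> le; have hac : adj a c.
  case/orP: hc => [/eqP eca|]; last by rewrite adj_sym.
  by move: le; rewrite eca dl; lia.
exists c => //; have := tdist_adj_le N b (etrans (adj_sym c a) hac); lia.
Qed.

(* Non-backtracking walks. *)
Fixpoint nbwalk (s : seq (vert G)) : bool :=
  if s is x :: s1 then
    (if s1 is y :: s2 then adj x y && (if s2 is z :: _ then x != z else true)
     else true) && nbwalk s1
  else true.

Lemma nbwalk_path x s : nbwalk (x :: s) -> path (@adj G) x s.
Proof.
elim: s x => [//|y s IH] x /=; case/andP=> /andP[-> _] h.
exact: IH.
Qed.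

(** A repeated vertex [x] closes the cycle [x :: s2], shorter than [L]; its length is at least 3
    because the walk does not backtrack and there are no loops. *)
Lemma nbwalk_uniq L s : girth_ge G L -> size s <= L -> nbwalk s -> uniq s.
Proof.
move=> girth; elim: s => [//|x s IH] les hs.
have us : uniq s by apply: IH; [exact: ltnW | case/andP: hs].
rewrite /= us andbT; apply/negP => xs.
case/splitPr: xs us les hs => s2 s3 us les hs.
have: has_cycle_of_length G (size s2).+1.
  exists (x :: s2); split=> //.
  - case: s2 hs {us les} => [|y [|z s2]] //=; first by rewrite adj_irr.
    by rewrite eqxx andbF.
  - move: us; rewrite cat_uniq /= negb_or => /and3P[-> /andP[-> _] _] //.
  - move/nbwalk_path: hs; rewrite cat_path /= rcons_path.
    by case/and3P=> -> ->.
move/girth; move: les; rewrite /= size_cat /=; lia.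
Qed.

(** Two walks leaving through one edge in opposite directions can be glued, since sharing that edge
    prevents backtracking at the junction. *)
Lemma nbwalk_catrev x y s t : nbwalk (x :: y :: s) -> nbwalk (y :: x :: t) ->
  nbwalk (catrev s (y :: x :: t)).
Proof.
elim: s x y t => [//|z s IH] x y t hx hy.
rewrite /=; apply: (IH y z (x :: t)); first by case/andP: hx.
case/and3P: hx => /andP[_ nxz] /andP[adjyz _] _.
by apply/andP; split=> //; rewrite adj_sym adjyz eq_sym.
Qed.

(** A geodesic from [b] first moves to a vertex nearer to [x] than [b]; [a] is not nearer, so the
    geodesic does not turn back to [a]. *)
Lemma geodesic_nbwalk N x l a b :
  adj a b -> tdist N b x = l -> l < N -> l <= tdist N a x ->
  exists p, [/\ size p = l, last b p = x & nbwalk [:: a, b & p]].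
Proof.
elim: l a b => [|l IH] a b hab dl ltN lea.
  exists [::]; split=> //=; last by rewrite hab.
  by apply/eqP; rewrite -(tdist_eq0 _ _ ltN) dl.
have [c hbc dc] := tdist_descent dl ltN.
have [|p [sp lp np]] := IH b c hbc dc (ltnW ltN); first by rewrite dl.
exists (c :: p); split=> //=; first by rewrite sp.
apply/andP; split=> //; rewrite hab /=.
by apply: contraTneq lea => ->; rewrite dc ltnn.
Qed.

End Distance.

Section TreeLike.
Variables (G : fingraph) (N : nat).
Hypothesis girthN : girth_ge G (N.*2.+1).
Implicit Types a b c i j k u v x y z : vert G.
Local Notation d := (@tdist G N).

(** Otherwise geodesics from [b] and [b'] to [x], joined through [a], form a non-backtracking walk
    meeting [x] twice. Each has length at most [N - 1], so the walk has at most [2 N + 1] vertices;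
    this fixes the girth bound. *)
Lemma descent_unique x a b b' : adj a b -> adj a b' -> d a x < N ->
  d b x <= d a x -> d b' x <= d a x -> b = b'.
Proof.
move=> hb hb' ltN leb leb'; apply/eqP/contraT => neb.
have [p [sp lp np]] := geodesic_nbwalk hb (erefl _) (leq_ltn_trans leb ltN) leb.
have [p' [sp' lp' np']] :=
  geodesic_nbwalk hb' (erefl _) (leq_ltn_trans leb' ltN) leb'.
have /(nbwalk_catrev np) nw : nbwalk [:: b, a, b' & p'].
  by apply/andP; split=> //; rewrite adj_sym hb.
have/(nbwalk_uniq girthN): size (catrev p [:: b, a, b' & p']) <= N.*2.+1.
  rewrite catrevE size_cat size_rev /=; lia.
move/(_ nw); rewrite -[catrev _ _]/(catrev (b :: p) _) catrevE cat_uniq.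
case/and3P=> _ /hasPn h _.
have /h : x \in [:: a, b' & p'] by rewrite -lp' in_cons mem_last orbT.
by rewrite /= mem_rev -lp mem_last.
Qed.

(** Local bipartiteness: a neighbour [b] not farther from [x] than [a] must be the unique neighbour
    on a geodesic from [a] to [x], hence strictly nearer. *)
Lemma adj_tdist x a b : adj a b -> d a x < N ->
  d b x = (d a x).+1 \/ d a x = (d b x).+1.
Proof.
move=> hab ltN; have le := tdist_adj_le N x hab.
case: (ltnP (d a x) (d b x)) => [lt|leb]; first by left; lia.
right; case dl : (d a x) => [|l].
  have /eqP ax : a == x by rewrite -(tdist_eq0 (N := N)) ?dl //; lia.
  have /eqP bx : b == x.
    by rewrite -(tdist_eq0 (N := N)) -?leqn0; lia.
  by move: hab; rewrite ax bx adj_irr.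
have [|c hac dc] := tdist_descent dl; first by rewrite -dl.
by rewrite (@descent_unique x a b c) ?dc //; lia.
Qed.

(** The edge from [x] to [y] leads towards [v] and away from [u], so [x] lies on a geodesic from [u]
    to [v]. The induction slides this edge towards [v]. *)
Lemma tdist_between x y u v : adj x y -> d y v < d x v -> d x u < d y u ->
  d x u + d x v < N -> d u v = d x u + d x v.
Proof.
move: {2}(d x v) (leqnn (d x v)) => n.
elim: n x y => [|n IH] x y; first by lia.
move=> len hxy dv du ltN.
have eu : d y u = (d x u).+1 by have := tdist_adj_le N u hxy; lia.
have ev : d x v = (d y v).+1.
  by have := tdist_adj_le N v (etrans (adj_sym y x) hxy); lia.
case dl : (d y v) => [|l].
  have/eqP eyv : y == v by rewrite -(tdist_eq0 (N := N)) ?dl //; lia.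
  have -> : d u v = d y u by rewrite tdistC eyv.
  by lia.
have [|z hyz dz] := tdist_descent dl; first by lia.
rewrite (IH y z) //; try lia.
have [|h|h] := adj_tdist hyz (x := u); [lia | lia |].
(* If [z] were nearer to [u] than [y], then [x] and [z] would both descend from [y] towards [u] and
   coincide; but [z] is nearer to [v] than [y], and [x] is not. *)
suff exz : x = z by move: dz; rewrite -exz; lia.
by apply: (@descent_unique u y); rewrite // ?[adj y x]adj_sym //; lia.
Qed.

(** Four-point condition of trees. Move [x] towards [i] as long as this also approaches [j]. Once it
    does not, [x] lies between [i] and [j], and also between [i] and [k] or between [j] and [k]. The
    bound keeps these distances below the truncation. *)
Lemma tdist_four_point x i j k : (d x i).*2 + d x j + d i k < N ->
  d x k + d i j <= d x i + d j k \/ d x k + d i j <= d x j + d i k.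
Proof.
move: {2}(d x i) (leqnn (d x i)) => n.
elim: n x => [|n IH] x len ltN.
  have/eqP -> : x == i by rewrite -(tdist_eq0 (N := N)) -?leqn0 //; lia.
  by right; lia.
have tk := tdist_triangle N i x k.
case dl : (d x i) => [|l].
  have/eqP -> : x == i by rewrite -(tdist_eq0 (N := N)) ?dl //; lia.
  by right; lia.
have [|y hxy dy] := tdist_descent dl; first by lia.
have lek : d x k <= (d y k).+1 by rewrite tdist_adj_le // adj_sym.
have [|ej|ej] := adj_tdist hxy (x := j); [lia| |]; last first.
  by have := IH y; rewrite dy; lia.
have eji : d j i = d x j + d x i by apply: (@tdist_between x y); lia.
rewrite (tdistC _ i j) eji.
have [|ek|ek] := adj_tdist hxy (x := k); [lia| |].
  have : d k i = d x k + d x i by apply: (@tdist_between x y); lia.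
  by rewrite (tdistC _ k i); lia.
have -> : d j k = d x j + d x k by apply: (@tdist_between x y); lia.
by left; lia.
Qed.

End TreeLike.

(** * Cardinalities of balls *)

Definition order_var : {mpoly int[2]} := 'X_ord0.
Definition degree_var : {mpoly int[2]} := 'X_ord_max.

Section Eval2.
Local Open Scope ring_scope.
Variables t1 t2 : int.

Lemma eval2D p q : eval2 (p + q) t1 t2 = eval2 p t1 t2 + eval2 q t1 t2.
Proof. exact: mevalD. Qed.
Lemma eval2N p : eval2 (- p) t1 t2 = - eval2 p t1 t2.
Proof. exact: mevalN. Qed.
Lemma eval2M p q : eval2 (p * q) t1 t2 = eval2 p t1 t2 * eval2 q t1 t2.
Proof. exact: mevalM. Qed.
Lemma eval2_0 : eval2 0 t1 t2 = 0. Proof. exact: meval0. Qed.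
Lemma eval2_1 : eval2 1 t1 t2 = 1. Proof. exact: meval1. Qed.
Lemma eval2X : eval2 order_var t1 t2 = t1. Proof. by rewrite /eval2 mevalXU. Qed.
Lemma eval2Y : eval2 degree_var t1 t2 = t2. Proof. by rewrite /eval2 mevalXU. Qed.

Lemma eval2_sum (I : Type) (r : seq I) (P : pred I) (F : I -> {mpoly int[2]}) :
  eval2 (\sum_(i <- r | P i) F i) t1 t2 = \sum_(i <- r | P i) eval2 (F i) t1 t2.
Proof.
elim/big_rec2: _ => [|i x y _ IH]; first exact: eval2_0.
by rewrite eval2D IH.
Qed.

Definition eval2E := (eval2D, eval2N, eval2M, eval2_0, eval2_1, eval2X, eval2Y).
End Eval2.

Local Notation evalG p G q := (eval2 p (Posz #|vert G|) (Posz q)).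

(** Ball sizes in the [q]-regular tree, by a linear recurrence that avoids the division by [q - 2]
    of the closed form. *)
Fixpoint ball_poly (r : nat) : {mpoly int[2]} :=
  if r is r1.+1 then
    if r1 is r2.+1 then (degree_var * ball_poly r1 - (degree_var - 1) * ball_poly r2)%R
    else (1 + degree_var)%R
  else 1%R.

(** Common part of the two balls of radius [r] centred at the ends of an edge; the recurrence is
    inclusion-exclusion, see [card_edge_ball]. *)
Fixpoint edge_ball_poly (r : nat) : {mpoly int[2]} :=
  if r is r1.+1 then (ball_poly r1 + ball_poly r1 - edge_ball_poly r1)%R
  else 0%R.

Lemma card_setE (T : finType) (P : pred T) :
  #|[set x | P x]| = \sum_(x : T) (P x : nat).
Proof. 
by rewrite -sum1_card big_mkcond; apply: eq_bigr => x _; rewrite inE; case: (P x).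
 Qed.

Section Balls.
Variables (G : fingraph) (q N : nat).
Hypothesis regq : regular G q.
Hypothesis girthN : girth_ge G (N.*2.+1).
Implicit Types a b c x y z : vert G.
Local Notation d := (@tdist G N).

Lemma sum_adj a : \sum_(b | adj a b) 1 = q.
Proof. by rewrite sum1_card -(regq a) cardsE. Qed.

(** If [d a x <= r], all [q] neighbours of [a] count; if [d a x] is [r + 1] or [r + 2], only the
    descending one does; beyond that, none. Summing over [x] gives the recurrence for balls. *)
Lemma nbrs_in_ball r a x : r.+2 < N ->
  \sum_(b | adj a b) (d b x <= r.+1 : nat) + (d a x <= r) =
  (d a x <= r.+2) + q * (d a x <= r).
Proof.
move=> ltN.
have far b : adj a b -> d a x <= (d b x).+1.
  by move=> h; rewrite tdist_adj_le // adj_sym.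
case: (leqP (d a x) r) => [le|lt].
  rewrite (eq_bigr (fun _ => 1)) ?sum_adj; first by lia.
  by move=> b hab; have := tdist_adj_le N x hab; lia.
rewrite muln0 !addn0; case: leqP => [le|lt2]; last first.
  by rewrite big1 // => b /far; lia.
case dl : (d a x) (lt) (le) => [//|l] lt' le'.
have [|c hac dc] := tdist_descent dl; first by lia.
rewrite (bigD1 c) //= dc big1; first by lia.
move=> b /andP[hab neb]; apply/eqP; rewrite eqb0; apply: contra_neqN neb => hb.
apply: (descent_unique girthN hab hac (x := x)); lia.
Qed.

Lemma ball_rec r a : r.+2 < N ->
  \sum_(b | adj a b) #|[set x | d b x <= r.+1]| + #|[set x | d a x <= r]| =
  #|[set x | d a x <= r.+2]| + q * #|[set x | d a x <= r]|.
Proof.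
move=> ltN; rewrite !card_setE big_distrr -!big_split /=.
under eq_bigr do rewrite card_setE.
rewrite exchange_big -big_split /=.
by apply: eq_bigr => x _; apply: nbrs_in_ball.
Qed.

Lemma card_ball0 a : 0 < N -> #|[set x | d a x <= 0]| = 1.
Proof.
move=> N0; rewrite (_ : [set _ | _] = [set a]) ?cards1 //.
by apply/setP=> x; rewrite !inE leqn0 tdist_eq0 // eq_sym.
Qed.

Lemma card_ball1 a : 1 < N -> #|[set x | d a x <= 1]| = q.+1.
Proof.
move=> N1; rewrite (_ : [set _ | _] = a |: [set x | adj a x]).
  by rewrite cardsU1 inE adj_irr regq.
by apply/setP=> x; rewrite !inE -within_tdist // within1.
Qed.

Lemma card_ball r a : r < N -> Posz #|[set x | d a x <= r]| = evalG (ball_poly r) G q.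
Proof.
elim/ltn_ind: r a => -[|[|r]] IH a ltN.
- by rewrite card_ball0 // eval2E.
- by rewrite card_ball1 // !eval2E; lia.
have /(congr1 Posz) := ball_rec a ltN.
have eb: \sum_(b | adj a b) #|[set x | d b x <= r.+1]|
    = q * #|[set x | d a x <= r.+1]|.
  have eqb b : #|[set x | d b x <= r.+1]| = #|[set x | d a x <= r.+1]|.
    have := IH r.+1 (ltnSn _) b (ltnW ltN).
    by rewrite -(IH r.+1 (ltnSn _) a (ltnW ltN)) => -[].
  rewrite (eq_bigr (fun _ => 1 * #|[set x | d a x <= r.+1]|)); last first.
    by move=> b _; rewrite mul1n.
  by rewrite -big_distrl /= sum_adj.
rewrite eb !PoszD !PoszM (IH r.+1) ?(IH r) //; try lia.
set p1 := ball_poly r.+1; set p0 := ball_poly r => h.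
have -> : ball_poly r.+2 = (degree_var * p1 - (degree_var - 1) * p0)%R by [].
rewrite !eval2E; lia.
Qed.

(** By the recurrence, each sphere is [q - 1] times the preceding one. *)
Lemma ball_lower r a : r.+1 < N -> 0 < q ->
  #|[set x | d a x <= r]| + q.-1 ^ r <= #|[set x | d a x <= r.+1]|.
Proof.
move=> ltN q0; elim: r ltN => [|r IH] ltN.
  by rewrite card_ball0 ?card_ball1 ?expn0; lia.
have {}IH := IH (ltnW ltN).
have := ball_rec a ltN.
rewrite (eq_bigr (fun _ => 1 * #|[set x | d a x <= r.+1]|)); last first.
  move=> b _; rewrite mul1n; have := card_ball b (ltnW ltN).
  by rewrite -(card_ball a (ltnW ltN)) => -[].
rewrite -big_distrl /= sum_adj expnS; case: q q0 IH => // q' _ /=; nia.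
Qed.

(** A sphere of radius [2 K + 1] has at least [(q - 1)^(2 K)] vertices, and [(q - 1)^2 >= q] as soon
    as [q >= 3]. *)
Lemma expn_le_order K : K.*2.+1 < N -> 2 < q -> 0 < #|vert G| ->
  q ^ K <= #|vert G|.
Proof.
move=> ltN q2 /card_gt0P[a _].
have := ball_lower a ltN (ltnW (ltnW q2)).
have : #|[set x | d a x <= K.*2.+1]| <= #|vert G| by exact: max_card.
have : q ^ K <= q.-1 ^ K.*2.
  rewrite -mul2n expnM; case: (K) => // k; rewrite leq_exp2r //.
  by case: q q2 => [|[|[|q']]] //= _; nia.
lia.
Qed.

Lemma card_edge_ball r a b : adj a b -> r < N ->
  Posz #|[set x | (d x a <= r) && (d x b <= r)]| = evalG (edge_ball_poly r) G q.
Proof.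
move=> hab; elim: r => [|r IH] ltN.
  rewrite eval2E (_ : [set _ | _] = set0) ?cards0 //.
  apply/setP=> x; rewrite !inE !leqn0 !tdist_eq0 //.
  by apply: contraTF hab => /andP[/eqP<- /eqP<-]; rewrite adj_irr.
have := card_ball a (ltnW ltN); have := card_ball b (ltnW ltN).
have := IH (ltnW ltN).
rewrite /= !eval2E; set B := [set x | d b x <= r]; set A := [set x | d a x <= r].
have -> : [set x | (d x a <= r) && (d x b <= r)] = A :&: B.
  by apply/setP=> x; rewrite !inE !(tdistC _ x).
(* The distances from [x] to the two ends differ by exactly one, so both are at most [r + 1] iff one
   of them is at most [r]. *)
have -> : [set x | (d x a <= r.+1) && (d x b <= r.+1)] = A :|: B.
  apply/setP=> x; rewrite !inE !(tdistC _ x).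
  have := adj_tdist girthN hab (x := x).
  have := adj_tdist girthN (etrans (adj_sym b a) hab) (x := x).
  lia.
have := cardsUI A B; lia.
Qed.

(** The centre [a] moves one step towards [b] and its ball shrinks by one. A point [x] that this
    step recedes from has [d x b = d a x + d a b]; being within [s] of [b] forces [d a x + 2 <= r],
    so it is not lost. *)
Lemma two_balls_shift r s a b a' : adj a a' -> d a b = (d a' b).+1 ->
  s.+2 <= r + d a b -> d a b <= r + s -> r + d a b < N ->
  [set x | (d x a <= r) && (d x b <= s)] =
  [set x | (d x a' <= r.-1) && (d x b <= s)].
Proof.
move=> haa dab les ler ltN; apply/setP=> x; rewrite !inE !(tdistC _ x).
have h1 := tdist_adj_le N x (etrans (adj_sym a' a) haa).
case: (ltnP r (d a x)) => [|le]; first by lia.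
have [|h|h] := adj_tdist girthN haa (x := x); [lia| |lia].
have : d x b = d a x + d a b by apply: (tdist_between girthN haa); lia.
rewrite (tdistC _ x); lia.
Qed.

End Balls.

(** * Intersections of balls *)

(** Shifting a centre towards the other lowers [D], until the balls are concentric, disjoint, or
    centred at the ends of an edge with equal radii. *)
Lemma two_balls_poly D r s : exists P, forall (G : fingraph) q N,
  regular G q -> girth_ge G N.*2.+1 -> D + r + s < N ->
  forall a b : vert G, tdist N a b = D ->
  Posz #|[set x | (tdist N x a <= r) && (tdist N x b <= s)]| = evalG P G q.
Proof.
elim: D r s => [|D IH] r s.
  exists (ball_poly (minn r s)) => G q N regq girthN ltN a b dab.
  have/eqP <- : a == b by rewrite -(tdist_eq0 (N := N)) ?dab //; lia.
  rewrite -(card_ball regq girthN a) //; last by lia.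
  by congr (Posz #|pred_of_set _|); apply/setP=> x; rewrite !inE tdistC; lia.
have sub G N (a b : vert G) : tdist N a b = D.+1 -> D.+1 + r + s < N ->
  exists2 a', adj a a' & tdist N a' b = D.
  by move=> dab ltN; apply: tdist_descent => //; lia.
have [far|near] := ltnP (r + s) D.+1.
  exists 0%R => G q N _ _ _ a b dab; rewrite eval2_0.
  rewrite (_ : [set _ | _] = set0) ?cards0 //; apply/setP=> x; rewrite !inE.
  have := tdist_triangle N x a b; rewrite (tdistC _ a x); lia.
have [les|] := leqP s.+2 (r + D.+1).
  have [P hP] := IH r.-1 s; exists P => G q N regq girthN ltN a b dab.
  have [a' haa' da'] := sub _ _ _ _ dab ltN.
  rewrite (two_balls_shift girthN haa'); try lia.
  by apply: hP => //; lia.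
have [ler|] := leqP r.+2 (s + D.+1).
  have [P hP] := IH r s.-1; exists P => G q N regq girthN ltN a b dab.
  rewrite tdistC in dab.
  have [b' hbb' db'] := sub _ _ _ _ dab ltN.
  have swap r' s' c : [set x | (tdist N x a <= r') && (tdist N x c <= s')] =
     [set x | (tdist N x c <= s') && (tdist N x a <= r')].
    by apply/setP=> x; rewrite !inE andbC.
  rewrite swap (two_balls_shift girthN hbb') -?swap; try lia.
  by apply: hP => //; [lia | rewrite tdistC].
(* Neither shift applies: [r + D <= s] and [s + D <= r]. *)
move=> lt1 lt2; have [D0 ers] : D = 0 /\ r = s by lia.
subst D s; exists (edge_ball_poly r) => G q N regq girthN ltN a b dab.
have hab : adj a b by rewrite -(tdist_eq1 (N := N)) ?dab //; lia.
by apply: card_edge_ball => //; lia.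
Qed.

Lemma seq_arg_min (T : eqType) (s : seq T) (f : T -> nat) : s != [::] ->
  exists2 x, x \in s & forall y, y \in s -> f x <= f y.
Proof.
elim: s => [//|x [|y s] IH] _.
  by exists x; rewrite ?mem_head // => y; rewrite inE => /eqP->.
have [z zs hz] := IH isT; have [le|gt] := leqP (f x) (f z).
  exists x; first exact: mem_head.
  by move=> t; rewrite inE => /predU1P[->//|/hz]; apply: leq_trans.
exists z; first by rewrite inE zs orbT.
by move=> t; rewrite inE => /predU1P[->|/hz//]; apply: ltnW.
Qed.

(* In a tree, the intersection of pairwise meeting balls B(a_i, r_i) equals the
   intersection of the two balls minimising r_i + r_j - d(a_i, a_j): this is what
   the four-point condition says for such a pair. *)
Lemma balls_poly W R N (D : nat -> nat -> nat) (bs : seq (nat * nat)) :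
  5 * R < N -> all (fun b => (b.1 < W) && (b.2 <= R)) bs ->
  exists P, forall (G : fingraph) q, regular G q -> girth_ge G N.*2.+1 ->
  forall e : nat -> vert G,
  (forall i j, i < W -> j < W -> tdist N (e i) (e j) = D i j) ->
  Posz #|[set x | all (fun b => tdist N x (e b.1) <= b.2) bs]| = evalG P G q.
Proof.
move=> ltN /allP hbs.
have [->|bs0] := eqVneq bs [::].
  exists order_var => G q _ _ e _; rewrite eval2E; congr (Posz _).
  by rewrite -cardsT; congr #|pred_of_set _|; apply/setP=> x; rewrite !inE.
have [/allrelP close|nclose] :=
  boolP (allrel (fun b c => D b.1 c.1 <= b.2 + c.2) bs bs); last first.
  exists 0%R => G q _ _ e he; rewrite eval2_0.
  rewrite (_ : [set _ | _] = set0) ?cards0 //; apply/setP=> x; rewrite !inE.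
  apply: contraNF nclose => /allP hx; apply/allrelP => b c bb cb.
  have /andP[lb _] := hbs _ bb; have /andP[lc _] := hbs _ cb.
  rewrite -he //; apply: leq_trans (tdist_triangle _ x _ _) _.
  by rewrite leq_add ?hx // tdistC hx.
pose f (p : (nat * nat) * (nat * nat)) := p.1.2 + p.2.2 - D p.1.1 p.2.1.
have [|[[i r] [j s]]] := @seq_arg_min _ [seq (b, c) | b <- bs, c <- bs] f.
  by case: (bs) bs0.
case/allpairsP=> -[b c] /= [bb cb [eb ec]] hmin; rewrite -{}eb -{}ec in bb cb hmin.
have /andP[/= li ler] := hbs _ bb; have /andP[/= lj les] := hbs _ cb.
have hij := close _ _ bb cb; rewrite /= in hij.
have [P hP] := two_balls_poly (D i j) r s.
exists P => G q regq girthN e he.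
rewrite -(hP G q N regq girthN _ (e i) (e j)) ?he //; last by lia.
congr (Posz #|pred_of_set _|); apply/setP=> x; rewrite !inE.
apply/allP/andP => [hx|[hi hj] [k t] kb]; first by rewrite !(hx (_, _)).
have /andP[/= lk let_] := hbs _ kb.
have /= mi := hmin _ (allpairs_f pair bb kb).
have /= mj := hmin _ (allpairs_f pair kb cb).
have /= mk := close _ _ bb kb; have /= mk' := close _ _ kb cb.
rewrite /f /= in mi mj.
(* The four-point lemma needs [2 R + R + 2 R < N], whence [5 * R < N]. Minimality of the pair turns
   either alternative into [d x k <= t]; pairwise closeness makes the subtractions in [f] exact. *)
have := tdist_four_point girthN (x := x) (i := e i) (j := e j) (k := e k).
rewrite (tdistC _ (e j) (e k)) !he //; lia.
Qed.

(** Exact distances are traded one by one for ball conditions: distance [t <= R] is a ball minus the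
    next smaller ball, and the truncated value [R + 1] is the complement of the ball of radius
    [R]. *)
Lemma exact_balls_poly W R N (D : nat -> nat -> nat) (cs bs : seq (nat * nat)) :
  5 * R < N -> all (fun b => (b.1 < W) && (b.2 <= R)) bs ->
  all (fun c => (c.1 < W) && (c.2 <= R.+1)) cs ->
  exists P, forall (G : fingraph) q, regular G q -> girth_ge G N.*2.+1 ->
  forall e : nat -> vert G,
  (forall i j, i < W -> j < W -> tdist N (e i) (e j) = D i j) ->
  Posz #|[set x | all (fun c => tdist R.+1 x (e c.1) == c.2) cs &&
                  all (fun b => tdist N x (e b.1) <= b.2) bs]| = evalG P G q.
Proof.
move=> ltN; elim: cs bs => [|[j t] cs IH] bs hbs /=.
  by move=> _; apply: (balls_poly D ltN hbs).
case/andP=> /andP[lj let_] hcs.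
have hball s : s <= R -> all (fun b => (b.1 < W) && (b.2 <= R)) ((j, s) :: bs).
  by move=> les; rewrite /= lj les.
have [{}let_|gt] := leqP t R; last first.
  have {gt} et : t = R.+1 by lia.
  subst t; have [P hP] := IH _ hbs hcs; have [P' hP'] := IH _ (hball _ (leqnn R)) hcs.
  exists (P - P')%R => G q regq girthN e he; rewrite !eval2E.
  rewrite -(hP G q regq girthN e he) -(hP' G q regq girthN e he) !card_setE.
  apply/eqP; rewrite eq_sym subr_eq -PoszD -big_split /=; apply/eqP; congr Posz.
  apply: eq_bigr => x _; rewrite (@tdist_minn _ R.+1 N); last by lia.
  by do 2!case: (all _ _); rewrite /= ?andbT ?andbF; lia.
have [P hP] := IH _ (hball _ let_) hcs; case: t let_ hP => [|t] let_ hP.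
  exists P => G q regq girthN e he; rewrite -(hP G q regq girthN e he).
  congr (Posz #|pred_of_set _|); apply/setP=> x; rewrite !inE.
  rewrite (@tdist_minn _ R.+1 N); last by lia.
  by move=> /=; do 2!case: (all _ _); rewrite /= ?andbT ?andbF; lia.
have [P' hP'] := IH _ (hball _ (ltnW let_)) hcs.
exists (P - P')%R => G q regq girthN e he; rewrite !eval2E.
rewrite -(hP G q regq girthN e he) -(hP' G q regq girthN e he) !card_setE.
apply/eqP; rewrite eq_sym subr_eq -PoszD -big_split /=; apply/eqP; congr Posz.
apply: eq_bigr => x _; rewrite (@tdist_minn _ R.+1 N); last by lia.
by do 2!case: (all _ _); rewrite /= ?andbT ?andbF; lia.
Qed.

(** * Non-vanishing of polynomials *)

(** The threshold [L] is uniform in the graph, so such a statement holds at all but finitely many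
    [n] of any sequence as in the theorem. *)
Definition eventually (Q : fingraph -> nat -> Prop) : Prop :=
  exists L, forall G q, regular G q -> girth_ge G L -> L <= q ->
    0 < #|vert G| -> Q G q.

Lemma girth_ge_leq G L L' : L' <= L -> girth_ge G L -> girth_ge G L'.
Proof. by move=> le h l /h; apply: leq_trans. Qed.

Lemma eventually_and (A B : fingraph -> nat -> Prop) :
  eventually A -> eventually B -> eventually (fun G q => A G q /\ B G q).
Proof.
move=> [L hA] [L' hB]; exists (maxn L L') => G q rq gi lq G0.
by split; [apply: hA | apply: hB] => //; try (apply: girth_ge_leq gi); lia.
Qed.

Lemma eventually_imp (A B : fingraph -> nat -> Prop) :
  (forall G q, A G q -> B G q) -> eventually A -> eventually B.
Proof. by move=> h [L hA]; exists L => G q *; apply/h/hA. Qed.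

Lemma eventually_forall (T : finType) (A : T -> fingraph -> nat -> Prop) :
  (forall t, eventually (A t)) -> eventually (fun G q => forall t, A t G q).
Proof.
move=> /choice[L hL]; exists (\max_t L t) => G q rq gi lq G0 t.
have le : L t <= \max_t L t by apply: leq_bigmax.
by apply: hL => //; [apply: girth_ge_leq gi | apply: leq_trans lq].
Qed.

(** With second exponents at most [K], the weight [m0 * K.+1 + m1] encodes the lexicographic order.
    A drop in the exponent of [A] outweighs any [q ^ m1 * q], since [q ^ K.+1 <= A]. *)
Lemma monomial_dominated K (A q m0 m1 n0 n1 : nat) : 0 < q -> q ^ K.+1 <= A ->
  m1 <= K -> n1 <= K -> m0 * K.+1 + m1 < n0 * K.+1 + n1 ->
  A ^ m0 * q ^ m1 * q <= A ^ n0 * q ^ n1.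
Proof.
move=> q0 leA lem len lt; rewrite -mulnA -expnSr.
have A0 : 0 < A by apply: leq_trans leA; rewrite expn_gt0 q0.
have [e|lt0] := eqVneq m0 n0.
  by subst m0; rewrite leq_mul2l leq_pexp2l ?orbT //; lia.
have {}lt0 : m0 < n0 by nia.
apply: (@leq_trans (A ^ n0)); last by rewrite leq_pmulr // expn_gt0 q0.
rewrite -(subnK lt0) addnS -addSn addnC expnD leq_mul2l; apply/orP; right.
apply: (@leq_trans A); first by apply: leq_trans leA; rewrite leq_pexp2l.
by rewrite -[leqLHS]expn1 leq_pexp2l.
Qed.

Lemma eval2_monomials (p : {mpoly int[2]}) (A q : nat) :
  eval2 p (Posz A) (Posz q) =
  (\sum_(m <- msupp p) p@_m * Posz (A ^ m ord0 * q ^ m ord_max)%N)%R.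
Proof.
rewrite /eval2 mevalE; apply: eq_bigr => m _; congr (_ * _)%R.
rewrite !big_ord_recl big_ord0 /= mulr1 PoszM -!natz !natrX !natz.
by congr (_ * _ ^+ m _)%R; apply: val_inj.
Qed.

Lemma absz_add (u v : int) : absz (u + v)%R <= absz u + absz v.
Proof. lia. Qed.

(* Girth and degree large force |G| to dominate every power of the degree, so
   the lexicographically leading monomial of a polynomial dominates the rest. *)
Lemma eventually_eval_neq0 (p : {mpoly int[2]}) : p != 0%R ->
  eventually (fun G q => evalG p G q <> 0%R).
Proof.
move=> p0; pose K := \max_(m <- msupp p) (m : 'X_{1..2}) ord_max.
pose C := \sum_(m <- msupp p) absz (p@_m)%R.
pose w (m : 'X_{1..2}) := m ord0 * K.+1 + m ord_max.
pose S := \max_(m <- msupp p) w m.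
have leK m : m \in msupp p -> m ord_max <= K.
  by move=> hm; apply: leq_bigmax_seq.
have leS m : m \in msupp p -> w m <= S by move=> hm; apply: leq_bigmax_seq.
have [|n ns hn] := @seq_arg_min _ (msupp p) (fun m => S - w m).
  by rewrite msupp_eq0.
have lew m : m \in msupp p -> m != n -> w m < w n.
  move=> ms; apply: contraNT; rewrite -leqNgt => le.
  have ew : w m = w n by have := hn m ms; have := leS m ms; have := leS n ns; lia.
  have := leK m ms; have := leK n ns; move: ew; rewrite /w => ew len lem.
  have e0 : m ord0 = n ord0 by nia.
  have e1 : m ord_max = n ord_max by nia.
  apply/eqP/mnmP => i; case: (eqVneq i ord0) => [->//|ne].
  suff -> : i = ord_max by [].
  by apply: val_inj; case: i ne => -[|[|]].
(* The first summand is the girth that [expn_le_order] requires at exponent [K + 1]; the others give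
   [C < q] and [2 < q]. *)
exists ((K.+1.*2.+2).*2.+1 + C.+1 + 3) => G q rq gi lq G0.
have girthN : girth_ge G (K.+1.*2.+2).*2.+1 by apply: girth_ge_leq gi; lia.
have leA : q ^ K.+1 <= #|vert G|.
  by apply: (expn_le_order rq girthN) => //; lia.
rewrite eval2_monomials; set A := #|vert G| in leA *.
pose t (m : 'X_{1..2}) : nat := A ^ m ord0 * q ^ m ord_max.
rewrite (bigD1_seq n) ?msupp_uniq //= => /eqP; rewrite addr_eq0 => /eqP.
rewrite -[LHS]/(_ * Posz (t n))%R.
rewrite -[RHS]/(- \sum_(m <- msupp p | m != n) p@_m * Posz (t m))%R => ez.
have t0 : 0 < t n by rewrite muln_gt0 !expn_gt0; apply/andP; split; lia.
have c0 : 0 < absz (p@_n)%R by rewrite absz_gt0 -mcoeff_msupp.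
(* If the value were zero, the leading term would be balanced by terms each smaller by a factor [q],
   contradicting [C < q]. *)
have: t n * q <= C * t n.
  apply: (@leq_trans (absz (p@_n)%R * t n * q)).
    by rewrite leq_mul2r leq_pmull ?orbT.
  have -> : absz (p@_n)%R * t n =
     absz (\sum_(m <- msupp p | m != n) p@_m * Posz (t m))%R.
    by rewrite -[RHS]abszN -ez abszM.
  apply: (@leq_trans ((\sum_(m <- msupp p | m != n) absz (p@_m)%R * t m) * q)).
    rewrite leq_mul2r; apply/orP; right.
    elim/big_rec2: _ => [//|m x y _ le].
    by rewrite (leq_trans (absz_add _ _)) // abszM leq_add2l.
  rewrite big_distrl /C (bigD1_seq n) ?msupp_uniq //= mulnDl.
  apply: leq_trans (leq_addl _ _); rewrite big_distrl /=.
  rewrite big_seq_cond [leqRHS]big_seq_cond; apply: leq_sum => m /andP[ms ne].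
  rewrite -mulnA leq_mul2l; apply/orP; right.
  by apply: (monomial_dominated (K := K)); rewrite ?leK ?lew //; lia.
rewrite mulnC leq_mul2r; lia.
Qed.

(** * Types of tuples *)

Definition dtype W N := {ffun 'I_W * 'I_W -> 'I_N.+1}.

Definition tp W N (G : fingraph) (e : nat -> vert G) : dtype W N :=
  [ffun ij : 'I_W * 'I_W => inord (tdist N (e ij.1) (e ij.2))].

Lemma tpE W N (G : fingraph) (e : nat -> vert G) (i j : 'I_W) :
  tp W N e (i, j) = tdist N (e i) (e j) :> nat.
Proof. by rewrite ffunE inordK // ltnS tdist_leN. Qed.

Definition coarsen W M N (t : dtype W N) : dtype W M :=
  [ffun ij : 'I_W * 'I_W => inord (minn M (t ij))].

Lemma tp_coarsen W M N (G : fingraph) (e : nat -> vert G) : M <= N ->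
  tp W M e = coarsen M (tp W N e).
Proof.
move=> leMN; apply/ffunP=> -[i j]; rewrite [RHS]ffunE tpE -tdist_minn //.
by rewrite ffunE.
Qed.

Definition setv T (e : nat -> T) (i : nat) (x : T) := fun v => if v == i then x else e v.

Definition dist_vec W M (G : fingraph) (e : nat -> vert G) (x : vert G) :
  {ffun 'I_W -> 'I_M.+1} := [ffun j : 'I_W => inord (tdist M x (e j))].

Definition extend_type W M (i : nat) (t : dtype W M) (u : {ffun 'I_W -> 'I_M.+1})
  : dtype W M :=
  [ffun ab : 'I_W * 'I_W => if ab.1 == i :> nat then (if ab.2 == i :> nat then ord0 else u ab.2)
              else if ab.2 == i :> nat then u ab.1 else t ab].

(** Only row and column [i] of the distance matrix change, so the new type depends on [x] only
    through its distance vector. *)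
Lemma tp_setv W M (G : fingraph) (e : nat -> vert G) i x :
  tp W M (setv e i x) = extend_type i (tp W M e) (dist_vec W M e x).
Proof.
apply/ffunP=> -[a b]; rewrite !ffunE /setv /=.
case: (_ == i); case: (_ == i) => //; last by rewrite tdistC.
by rewrite tdistxx; apply: val_inj; rewrite /= inordK.
Qed.

Lemma dist_vec_poly W R N (t : dtype W N) (u : {ffun 'I_W -> 'I_R.+2}) :
  5 * R < N -> exists P, forall (G : fingraph) q,
    regular G q -> girth_ge G N.*2.+1 -> forall e : nat -> vert G,
    tp W N e = t -> Posz #|[set x | dist_vec W R.+1 e x == u]| = evalG P G q.
Proof.
move=> ltN.
pose D a b := if (insub a, insub b) is (Some i, Some j)
  then nat_of_ord (t (i, j)) else 0.
pose cs := [seq (val j, val (u j)) | j <- enum 'I_W].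
have hcs : all (fun c => (c.1 < W) && (c.2 <= R.+1)) cs.
  by apply/allP=> _ /mapP[j _ ->] /=; rewrite ltn_ord -ltnS ltn_ord.
have [P hP] := @exact_balls_poly W R N D cs [::] ltN isT hcs.
exists P => G q rq gi e et; rewrite -(hP G q rq gi e); last first.
  move=> i j li lj; rewrite /D !insubT /= -et.
  by rewrite tpE.
congr (Posz #|pred_of_set _|); apply/setP=> x; rewrite !inE andbT.
apply/eqP/allP => [eu _ /mapP[j _ ->] /=|h].
  by rewrite -eu ffunE inordK // ltnS tdist_leN.
apply/ffunP=> j; apply: val_inj; rewrite ffunE /= inordK ?ltnS ?tdist_leN //.
by apply/eqP; apply: (h (val j, val (u j))); apply: map_f; rewrite mem_enum.
Qed.

(** * Properties decided by types, and elimination of quantifiers *)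

Definition gpred := forall G : fingraph, (nat -> vert G) -> Prop.

Definition type_definable W (F : gpred) := exists N (Th : pred (dtype W N)),
  eventually (fun G q => forall e : nat -> vert G, F G e <-> Th (tp W N e)).

(** Finer types determine coarser ones, so two properties can be read at a common precision. *)
Lemma type_definable_refine W (F : gpred) : type_definable W F ->
  exists M, forall N, M <= N -> exists Th : pred (dtype W N),
    eventually (fun G q => forall e : nat -> vert G, F G e <-> Th (tp W N e)).
Proof.
move=> [M [Th hTh]]; exists M => N leMN; exists (fun t => Th (coarsen M t)).
by apply: eventually_imp hTh => G q h e; rewrite -tp_coarsen.
Qed.

Lemma type_definable_not W (F : gpred) :
  type_definable W F -> type_definable W (fun G e => ~ F G e).
Proof.
move=> [N [Th h]]; exists N, (predC Th).
by apply: eventually_imp h => G q h e /=; rewrite h; split=> /negP.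
Qed.

Lemma type_definable_and W (F F' : gpred) : type_definable W F ->
  type_definable W F' -> type_definable W (fun G e => F G e /\ F' G e).
Proof.
move=> /type_definable_refine[N h] /type_definable_refine[N' h'].
have [Th hTh] := h _ (leq_maxl N N'); have [Th' hTh'] := h' _ (leq_maxr N N').
exists (maxn N N'), (predI Th Th').
apply: eventually_imp (eventually_and hTh hTh') => G q [k k'] e /=.
by rewrite k k'; split=> /andP.
Qed.

Lemma type_definable_ext W (F F' : gpred) : (forall G e, F G e <-> F' G e) ->
  type_definable W F -> type_definable W F'.
Proof.
move=> eF [N [Th h]]; exists N, Th.
by apply: eventually_imp h => G q h e; rewrite -eF.
Qed.

(** Sort the vertices [x] by distance vector. On each class [F] is constant, as decided by
    [extend_type], so the count is the sum of the class polynomials over the classes where it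
    holds. *)
Lemma type_definable_count W (F : gpred) i : type_definable W F ->
  exists N (P : dtype W N -> {mpoly int[2]}),
  eventually (fun G q => forall e : nat -> vert G,
    Posz #|[set x | `[< F G (setv e i x) >]]| = evalG (P (tp W N e)) G q).
Proof.
move=> /type_definable_refine[R /(_ _ (leqnSn R)) [Th hTh]].
pose N := (5 * R).+1; have ltN : 5 * R < N by [].
have /choice[Q hQ] (tu : dtype W N * {ffun 'I_W -> 'I_R.+2}) :=
  dist_vec_poly tu.1 tu.2 ltN.
pose ok (t : dtype W N) u := Th (extend_type i (coarsen R.+1 t) u).
exists N, (fun t => \sum_(u | ok t u) Q (t, u))%R.
have {}hQ : eventually (fun G q => forall (tu : dtype W N * {ffun 'I_W -> 'I_R.+2}) 
    (e : nat -> vert G), tp W N e = tu.1 ->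
    Posz #|[set x | dist_vec W R.+1 e x == tu.2]| = evalG (Q tu) G q).
  exists N.*2.+1 => G q rq gi _ _ tu e; exact: hQ.
apply: eventually_imp (eventually_and hTh hQ) => G q [{}hTh {}hQ] e.
rewrite eval2_sum card_setE (partition_big (dist_vec W R.+1 e) predT) //=.
rewrite [RHS]big_mkcond -natz raddf_sum /=; apply: eq_bigr => u _.
have hF x : dist_vec W R.+1 e x == u ->
    `[< F G (setv e i x) >] = ok (tp W N e) u.
  move/eqP=> eu; rewrite /ok -tp_coarsen; last by rewrite /N; lia.
  by rewrite -eu -tp_setv; apply/asboolP/idP; rewrite hTh.
under eq_bigr => x hx do rewrite (hF x hx).
case: ifP => _; last by rewrite big1.
rewrite -(hQ (tp W N e, u) e) // natz; congr Posz.
by rewrite card_setE big_mkcond.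
Qed.

Lemma type_definable_ex W (F : gpred) i : type_definable W F ->
  type_definable W (fun G e => exists x, F G (setv e i x)).
Proof.
move=> /(type_definable_count i)[N [P hP]]; exists N, (fun t => P t != 0%R).
(* There are finitely many types, so one threshold serves all nonzero polynomials [P t]. *)
have: eventually (fun G q => forall t, P t != 0%R -> evalG (P t) G q <> 0%R).
  apply: eventually_forall => t; have [->|nz] := eqVneq (P t) 0%R.
    by exists 0.
  by apply: eventually_imp (eventually_eval_neq0 nz).
move=> nz; apply: eventually_imp (eventually_and hP nz) => G q [{}hP {}nz] e.
split=> [[x hx]|/nz].
  apply/eqP => e0; have := hP e; rewrite e0 eval2_0 => -[/eqP].
  by rewrite cards_eq0 => /eqP/setP/(_ x); rewrite !inE asboolT.
rewrite -hP => h; have: #|[set x | `[< F G (setv e i x) >]]| != 0.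
  by apply/eqP => h0; apply: h; rewrite h0.
by rewrite -lt0n => /card_gt0P[x]; rewrite inE => /asboolP; exists x.
Qed.

(** * Formulas *)

Section SatFacts.
Variables (T : Type) (eqT E : T -> T -> Prop).

Lemma sat_ext f (P : nat -> bool) (env env' : nat -> option T) :
  free_in P f -> (forall v, P v -> env v = env' v) ->
  sat eqT E env f <-> sat eqT E env' f.
Proof.
elim: f P env env' =>
  [i j|i j|g IH|g IHg h IHh|g IHg h IHh|i g IH|i g IH] P env env' /=.
- by case/andP=> Pi Pj h; rewrite !h.
- by case/andP=> Pi Pj h; rewrite !h.
- by move=> fg h; rewrite (IH P env env').
- by case/andP=> fg fh k; rewrite (IHg P env env') // (IHh P env env').
- by case/andP=> fg fh k; rewrite (IHg P env env') // (IHh P env env').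
- move=> fg h; have hu a : sat eqT E (upd env i a) g <-> sat eqT E (upd env' i a) g.
    by apply: IH fg _ => v; rewrite /upd; case: eqP => //= _ /h.
  by split=> -[a /hu]; exists a.
- move=> fg h; have hu a : sat eqT E (upd env i a) g <-> sat eqT E (upd env' i a) g.
    by apply: IH fg _ => v; rewrite /upd; case: eqP => //= _ /h.
  by split=> k a; apply/hu.
Qed.

Definition FTrue := FAll 0 (FEq 0 0).
Definition bigFAnd := foldr FAnd FTrue.
Definition bigFOr := foldr FOr (FNeg FTrue).

Hypothesis eqT_refl : forall a, eqT a a.

Lemma sat_FTrue env : sat eqT E env FTrue.
Proof. by move=> a; apply: eqT_refl. Qed.

Lemma sat_bigFAnd (I : eqType) (s : seq I) (F : I -> formula) env :
  sat eqT E env (bigFAnd [seq F i | i <- s]) <->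
  forall i, i \in s -> sat eqT E env (F i).
Proof.
elim: s => [|x s IH]; first by split=> // _; exact: sat_FTrue.
rewrite [map _ _]/= [bigFAnd _]/= [sat _ _ _ _]/= IH; split.
  by case=> hx hs i; rewrite inE => /predU1P[->//|/hs].
by move=> h; split=> [|i si]; apply: h; rewrite inE ?eqxx ?si ?orbT.
Qed.

Lemma sat_bigFOr (I : eqType) (s : seq I) (F : I -> formula) env :
  sat eqT E env (bigFOr [seq F i | i <- s]) <->
  exists2 i, i \in s & sat eqT E env (F i).
Proof.
elim: s => [|x s IH]; first by split=> [|[]//]; case; exact: sat_FTrue.
rewrite [map _ _]/= [bigFOr _]/= [sat _ _ _ _]/= IH; split.
  by case=> [hx|[i si hi]]; [exists x | exists i] => //; rewrite inE ?eqxx ?si ?orbT.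
by case=> i; rewrite inE => /predU1P[->|si hi]; [left | right; exists i].
Qed.

End SatFacts.

Lemma free_in_bigFAnd P s : all (free_in P) s -> free_in P (bigFAnd s).
Proof. by elim: s => [//|f s IH] /= /andP[-> /IH]. Qed.

Lemma free_in_bigFOr P s : all (free_in P) s -> free_in P (bigFOr s).
Proof. by elim: s => [//|f s IH] /= /andP[-> /IH]. Qed.

Fixpoint var_bound (f : formula) : nat :=
  match f with
  | FAdj i j | FEq i j => maxn i j
  | FNeg g => var_bound g
  | FAnd g h | FOr g h => maxn (var_bound g) (var_bound h)
  | FEx i g | FAll i g => var_bound g
  end.

(** Environments are total and a quantifier overwrites slot [i], so [W] stays fixed throughout the
    induction. *)
Lemma formula_type_definable f W : var_bound f < W ->
  type_definable W (fun G e => gsat (fun v => Some (e v)) f).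
Proof.
have upd_setv (G : fingraph) (e : nat -> vert G) i x :
    upd (fun v => Some (e v)) i x = fun v => Some (setv e i x v).
  by apply: funext => v; rewrite /upd /setv; case: eqP.
elim: f W => [i j|i j|g IH|g IHg h IHh|g IHg h IHh|i g IH|i g IH] W /=.
- rewrite gtn_max => /andP[li lj].
  (* Precision 2 separates distance 1 from larger distances; precision 1 suffices for equality. *)
  exists 2, (fun t : dtype W 2 => t (Ordinal li, Ordinal lj) == 1 :> nat).
  by exists 0 => G q _ _ _ _ e; rewrite tpE tdist_eq1.
- rewrite gtn_max => /andP[li lj].
  exists 1, (fun t : dtype W 1 => t (Ordinal li, Ordinal lj) == 0 :> nat).
  by exists 0 => G q _ _ _ _ e; rewrite tpE tdist_eq0 //; split=> /eqP.
- by move=> /IH/type_definable_not.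
- by rewrite gtn_max => /andP[/IHg hg /IHh hh]; apply: type_definable_and hg hh.
- rewrite gtn_max => /andP[/IHg/type_definable_not hg /IHh/type_definable_not hh].
  have := type_definable_not (type_definable_and hg hh).
  apply: type_definable_ext => G e; rewrite /gsat /=; split; last by tauto.
  by rewrite not_andE !not_notE.
- move/IH/(type_definable_ex i); apply: type_definable_ext => G e.
  by rewrite /gsat /=; split=> -[x hx]; exists x; move: hx; rewrite upd_setv.
- move/IH/type_definable_not/(type_definable_ex i)/type_definable_not.
  apply: type_definable_ext => G e; rewrite /gsat /=; split=> h x.
    by rewrite upd_setv; apply: contrapT => hx; apply: h; exists x.
  by case: x => x; apply; rewrite -upd_setv; apply: h.
Qed.

(** * Formulas defining types *)

Fixpoint distF (r i j : nat) : formula :=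
  if r is r'.+1 then
    let z := (i + j).+1 in
    FEx z (FAnd (FOr (FEq z i) (FAdj z i)) (distF r' z j))
  else FEq i j.

Lemma free_in_distF r i j (P : nat -> bool) : P i -> P j -> free_in P (distF r i j).
Proof.
elim: r i P => [|r IH] i P Pi Pj /=; first by rewrite Pi.
by rewrite eqxx Pi !orbT /= IH ?eqxx ?Pj ?orbT.
Qed.

Lemma gsat_distF (G : fingraph) r i j (a b : vert G) env :
  env i = Some a -> env j = Some b -> gsat env (distF r i j) <-> within r a b.
Proof.
elim: r i a env => [|r IH] i a env ei ej.
  by rewrite /gsat /= ei ej; split=> /eqP.
(* The bound variable exceeds both [i] and [j], so it captures neither. *)
set z := (i + j).+1.
have zi : (i == z) = false by rewrite /z; lia.
have zj : (j == z) = false by rewrite /z; lia.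
have hc c : gsat (upd env z c) (FAnd (FOr (FEq z i) (FAdj z i)) (distF r z j)) <->
    ((c == a) || adj c a) && within r c b.
  have hr : gsat (upd env z c) (distF r z j) <-> within r c b.
    by apply: IH; rewrite /upd ?eqxx // zj.
  rewrite /gsat [sat _ _ _ _]/= {1 2 3 4}/upd eqxx zi ei; split.
    by case=> h /hr ->; rewrite andbT; case: h => [->|->]; rewrite ?eqxx ?orbT.
  by case/andP=> h /hr hr'; split=> //; case/orP: h => [/eqP|]; [left | right].
split=> [[c /hc h]|/existsP[c /hc h]]; last by exists c.
by apply/existsP; exists c.
Qed.

Definition sign (b : bool) (f : formula) := if b then f else FNeg f.

Lemma gsat_sign (G : fingraph) (env : nat -> option (vert G)) (b c : bool) f :
  (gsat env f <-> b) -> gsat env (sign c f) <-> b = c.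
Proof.
by rewrite /gsat => h; case: c => /=; rewrite h; case: b {h}; split.
Qed.

(* The variable i of a type is read off at the variable sg i; when sg i = sg j no
   variable is mentioned at all, so that a type in no parameters gives a sentence. *)
Definition typeF W N (sg : nat -> nat) (t : dtype W N) : formula :=
  bigFAnd [seq sign (t ijs.1 <= ijs.2)
             (if sg ijs.1.1 == sg ijs.1.2 then FTrue
              else distF ijs.2 (sg ijs.1.1) (sg ijs.1.2))
          | ijs : 'I_W * 'I_W * 'I_N <- enum {: 'I_W * 'I_W * 'I_N}].

Lemma free_in_typeF W N (sg : nat -> nat) (t : dtype W N) (P : nat -> bool) :
  (forall v w, sg v != sg w -> P (sg v)) -> free_in P (typeF sg t).
Proof.
move=> hP; rewrite /typeF; apply: free_in_bigFAnd.
rewrite all_map; apply/allP=> -[[i j] s] _ /=.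
have free_sign b f : free_in P (sign b f) = free_in P f by case: b.
rewrite free_sign; case: eqVneq => //= ne.
by apply: free_in_distF; [apply: hP ne | apply: hP; rewrite eq_sym; exact: ne].
Qed.

(** Knowing for every [s < N] whether the distance is at most [s] determines the truncated distance,
    by [tdistP]. *)
Lemma gsat_typeF W N (sg : nat -> nat) (t : dtype W N) (G : fingraph) env (e : nat -> vert G) :
  (forall v w, sg v = sg w -> e v = e w) ->
  (forall v w, sg v != sg w -> env (sg v) = Some (e v)) ->
  gsat env (typeF sg t) <-> t = tp W N e.
Proof.
move=> esg env_sg.
have hatom i j s : gsat env (if sg i == sg j then FTrue else distF s (sg i) (sg j))
    <-> within s (e i) (e j).
  case: eqVneq => [/esg ->|ne].
    by rewrite within_refl; split=> // _; exact: sat_FTrue.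
  by apply: gsat_distF; [apply: env_sg ne | apply: env_sg; rewrite eq_sym; exact: ne].
rewrite /typeF /gsat sat_bigFAnd //; split=> [h|-> -[[i j] s] _ /=].
  apply/ffunP=> -[i j]; apply: val_inj; rewrite /= tpE; apply/esym/eqP.
  apply/tdistP=> [|s lts]; first by rewrite -ltnS.
  have := h (i, j, Ordinal lts); rewrite mem_enum => /(_ isT) /=.
  exact: (gsat_sign _ (hatom i j s)).1.
rewrite -/(gsat _ _) (gsat_sign _ (hatom i j s)) tpE.
exact: within_tdist.
Qed.

(** * The theorem in finite graphs *)

Lemma finite_count_types m phi : free_in (fun v => v <= m) phi ->
  exists (T : finType) (P : T -> {mpoly int[2]}) (psi : T -> formula),
  (forall t, free_in (fun v => 0 < v <= m) (psi t)) /\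
  eventually (fun G q => forall a : 'I_m -> vert G, exists t0,
    (forall t, gsat (tup_env None a) (psi t) <-> t = t0) /\
    Posz (count_def phi a) = evalG (P t0) G q).
Proof.
move=> phi_ok; pose W := (var_bound phi).+1.
have [N [P hP]] := type_definable_count 0 (formula_type_definable (ltnSn (var_bound phi))).
(* Index 0, later overwritten by the object variable, and those above [m] are read at variable 1.
   For [m = 0] the map is constant and [e] is constantly [x0]. *)
pose sg v := if 0 < v <= m then v else 1.
have sg_ne v w : sg v != sg w -> 0 < sg v <= m.
  by rewrite /sg; case: ifP => // ; case: ifP => // ; lia.
exists (dtype W N), P, (fun t => typeF sg t); split=> [t|].
  exact: free_in_typeF.
case: hP => L hP; exists L => G q rq gi lq G0 a.
have [x0 _] := card_gt0P G0.
pose e v := odflt x0 (tup_env None a (sg v)).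
have env_e v : 0 < v <= m -> tup_env None a v = Some (odflt x0 (tup_env None a v)).
  by case: v => [//|j] /= lj; rewrite insubT.
exists (tp W N e); split=> [t|].
  apply: gsat_typeF => v w; first by rewrite /e => ->.
  by move=> /sg_ne/env_e.
rewrite -hP //; congr (Posz #|pred_of_set _|); apply/setP=> x; rewrite !inE.
apply: asbool_equiv_eq; apply: sat_ext phi_ok _ => -[//|j] lj.
by rewrite /setv /= /e /sg lj -env_e.
Qed.

(** Types with equal polynomials are merged. Distinct polynomials then eventually take distinct
    values, so the count determines the index. *)
Lemma finite_version m phi : free_in (fun v => v <= m) phi ->
  exists (k : nat) (p : 'I_k -> {mpoly int[2]}) (psi : 'I_k -> formula),
  (forall i, free_in (fun v => 0 < v <= m) (psi i)) /\
  eventually (fun G q => forall a : 'I_m -> vert G,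
    (exists i0, forall i, gsat (tup_env None a) (psi i) <-> i = i0) /\
    forall i, gsat (tup_env None a) (psi i) <->
              Posz (count_def phi a) = evalG (p i) G q).
Proof.
case/finite_count_types=> T [P [psi [psi_ok hev]]].
pose ps := undup [seq P t | t <- enum T].
pose p (i : 'I_(size ps)) := nth 0%R ps i.
have p_inj : injective p.
  move=> i j /eqP; rewrite nth_uniq ?undup_uniq // => /eqP; exact: val_inj.
have p_surj t : exists i, P t = p i.
  have Pt : P t \in ps by rewrite mem_undup map_f ?mem_enum.
  have lt : index (P t) ps < size ps by rewrite index_mem.
  by exists (Ordinal lt); rewrite /p nth_index.
exists (size ps), p, (fun i => bigFOr [seq psi t | t <- enum T & P t == p i]).
split=> [i|]; first 
  by apply: free_in_bigFOr; rewrite all_map; apply/allP=> t _; apply: psi_ok.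
have nz : eventually (fun G q => forall ij : 'I_(size ps) * 'I_(size ps),
    evalG (p ij.1) G q = evalG (p ij.2) G q -> ij.1 = ij.2).
  apply: eventually_forall => -[i j] /=; have [->|ne] := eqVneq i j.
    by exists 0.
  have: (p i - p j != 0)%R by rewrite subr_eq0 (inj_eq p_inj).
  move/eventually_eval_neq0; apply: eventually_imp => G q h e.
  by case: h; rewrite !eval2E e subrr.
apply: eventually_imp (eventually_and hev nz) => G q [{}hev {}nz] a.
have [t0 [ht0 cnt]] := hev a; have [i0 ei0] := p_surj t0.
have hpsi i : gsat (tup_env None a) (bigFOr [seq psi t | t <- enum T & P t == p i])
    <-> i = i0.
  rewrite /gsat sat_bigFOr //; split=> [[t]|->].
    rewrite mem_filter => /andP[/eqP et _] /ht0 e0.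
    by apply: p_inj; rewrite -et -ei0 e0.
  exists t0; last by apply/ht0.
  by rewrite mem_filter ei0 eqxx mem_enum.
split=> [|i]; first by exists i0.
rewrite hpsi cnt ei0; split=> [->//|/esym e0].
exact: (nz (i, i0)).
Qed.

(** * Los' theorem *)

Section Los.
Variables (H : nat -> fingraph) (U : (nat -> Prop) -> Prop).
Hypothesis ultraU : ultrafilter U.
Hypothesis H_gt0 : forall n, 0 < #|vert (H n)|.

Lemma ultra_mono (A B : nat -> Prop) : (forall n, A n -> B n) -> U A -> U B.
Proof. by case: ultraU => _ _ h _ _ AB UA; apply: h UA AB. Qed.

Lemma ultra_and (A B : nat -> Prop) : U (fun n => A n /\ B n) <-> U A /\ U B.
Proof.
case: ultraU => _ _ _ h _; split=> [UAB|[]]; last exact: h.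
by split; apply: ultra_mono UAB => n [].
Qed.

Lemma ultra_not (A : nat -> Prop) : U (fun n => ~ A n) <-> ~ U A.
Proof.
case: ultraU => _ U0 _ _ h; split=> [UnA UA|nUA]; last by case: (h A).
by apply: U0; apply: ultra_mono ((ultra_and _ _).2 (conj UA UnA)) => n [].
Qed.

Lemma ultra_exists (I : finType) (A : I -> nat -> Prop) :
  U (fun n => exists i, A i n) -> exists i, U (A i).
Proof.
move=> UA; apply: contrapT => /forallNP nU.
have : forall s : seq I, U (fun n => forall i, i \in s -> ~ A i n).
  elim=> [|i s IH]; first by case: ultraU => UT _ _ _ _; apply: ultra_mono UT.
  have /ultra_not UnA := nU i.
  apply: ultra_mono ((ultra_and _ _).2 (conj UnA IH)) => n [nA hs] j.
  by rewrite inE => /predU1P[->//|/hs].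
move/(_ (enum I)) => Un; case: ultraU => _ U0 _ _ _; apply: U0.
apply: ultra_mono ((ultra_and _ _).2 (conj UA Un)) => n [[i hi] hn].
by apply: (hn i) => //; rewrite mem_enum.
Qed.

Definition env_at n (env : nat -> option (uprod_carrier H)) :
  nat -> option (vert (H n)) := fun v => omap (fun a : uprod_carrier H => a n) (env v).

Lemma env_at_upd n env i a : env_at n (upd env i a) = upd (env_at n env) i (a n).
Proof. by apply: funext => v; rewrite /env_at /upd; case: eqP. Qed.

(** Choose a witness in each factor that has one and an arbitrary vertex elsewhere. *)
Lemma ultra_choice (A : forall n, vert (H n) -> Prop) :
  U (fun n => exists x, A n x) <-> exists a : uprod_carrier H, U (fun n => A n (a n)).
Proof.
split=> [UA|[a]]; last by apply: ultra_mono => n; exists (a n).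
have hch n : {x : vert (H n) | (exists y, A n y) -> A n x}.
  apply: cid; have [[y Ay]|nA] := pselect (exists y, A n y); first by exists y.
  by have [x _] := card_gt0P (H_gt0 n); exists x => /nA.
exists (fun n => sval (hch n)); apply: ultra_mono UA => n.
exact: svalP (hch n).
Qed.

Lemma los f env : usat U env f <-> U (fun n => gsat (env_at n env) f).
Proof.
elim: f env => [i j|i j|g IH|g IHg h IHh|g IHg h IHh|i g IH|i g IH] env.
(* With an unassigned variable both sides are false, because [U] omits the empty set. *)
- rewrite /usat /gsat /env_at /=; case: (env i) => [a|]; case: (env j) => [b|] //=;
  by case: ultraU => _ U0 _ _ _.
- rewrite /usat /gsat /env_at /=; case: (env i) => [a|]; case: (env j) => [b|] //=;
  by case: ultraU => _ U0 _ _ _.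
- by rewrite /gsat /= ultra_not -IH.
- by rewrite /gsat /= ultra_and -IHg -IHh.
- rewrite /usat /= -/(usat _ _ _) -/(usat _ _ _) IHg IHh.
  split=> [[|]|UU]; [by apply: ultra_mono => n; left |
    by apply: ultra_mono => n; right |].
  have [Ug|/ultra_not Ug] := pselect (U (fun n => gsat (env_at n env) g)).
    by left.
  right; apply: ultra_mono ((ultra_and _ _).2 (conj UU Ug)) => n [[]//].
- rewrite /gsat /= (ultra_choice (fun n x => gsat (upd (env_at n env) i x) g)).
  by split=> -[a ha]; exists a; move: ha; rewrite -?/(usat _ _ _) IH;
    apply: ultra_mono => n; rewrite env_at_upd.
- rewrite /usat /= -/(usat _ _ _); split=> [h|Uh a]; last first.
    by rewrite -/(usat _ _ _) IH; apply: ultra_mono Uh => n; rewrite env_at_upd; apply.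
  apply: contrapT => /ultra_not nU.
  have /(ultra_choice (fun n x => ~ gsat (upd (env_at n env) i x) g))[a] :
      U (fun n => exists x, ~ gsat (upd (env_at n env) i x) g).
    by apply: ultra_mono nU => n /existsNP.
  move/ultra_not; apply; have := h a; rewrite -/(usat _ _ _) IH.
  by apply: ultra_mono => n; rewrite env_at_upd.
Qed.

End Los.

Lemma ultra_cofinite U : nonprincipal_ultrafilter U ->
  forall k, U (fun n => k <= n).
Proof.
case=> ultraU np; elim=> [|k IH].
  by have [UT _ _ _ _] := ultraU; apply: (ultra_mono ultraU) UT.
have /(ultra_not ultraU) nk := np k.
apply: (ultra_mono ultraU) ((ultra_and ultraU _ _).2 (conj IH nk)) => n [].
by rewrite leq_eqVlt => /predU1P[->|].
Qed.

(** * Transfer to the ultraproduct *)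

Local Open Scope ring_scope.

Theorem theorem4p10 (m : nat) (phi : formula)
  (phi_ok : free_in (fun v => (v <= m)%N) phi) :
  exists (k : nat) (p : 'I_k -> {mpoly int[2]}) (psi : 'I_k -> formula),
    (forall i, free_in (fun v => (0 < v <= m)%N) (psi i)) /\
    forall (H : nat -> fingraph) (d : nat -> nat) (U : (nat -> Prop) -> Prop),
      (forall n, (0 < #|vert (H n)|)%N) ->
      (forall n, regular (H n) (d n)) ->
      tends_to_infty d ->
      girth_tends_to_infty H ->
      nonprincipal_ultrafilter U ->
      (* (1) psi_1(M^m), ..., psi_k(M^m) partition M^m *)
      (forall a : 'I_m -> uprod_carrier H,
          exists! i : 'I_k, usat U (tup_env None a) (psi i)) /\
      (* (2) M |= psi_i(a)  <->  |phi(M, a)| = p_i(alpha, beta) in R^U *)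
      (forall (a : 'I_m -> uprod_carrier H) (i : 'I_k),
          usat U (tup_env None a) (psi i) <->
          U (fun n => (count_def phi (fun j => a j n))%:Z
                      = eval2 (p i) (#|vert (H n)|)%:Z (d n)%:Z)).
Proof.
have [k [p [psi [psi_ok [L hL]]]]] := finite_version phi_ok.
exists k, p, psi; split=> // H d U H_gt0 reg dinf ginf npU.
have ultraU := npU.1.
have [Nd hd] := dinf L; have [Ng hg] := ginf L.
have good : U (fun n => forall a : 'I_m -> vert (H n),
    (exists i0, forall i, gsat (tup_env None a) (psi i) <-> i = i0) /\
    forall i, gsat (tup_env None a) (psi i) <->
              Posz (count_def phi a) = evalG (p i) (H n) (d n)).
  apply: (ultra_mono ultraU) (ultra_cofinite npU (maxn Nd Ng)) => n.
  by rewrite geq_max => /andP[/hd ln /hg gn]; apply: hL.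
have env_tup n (a : 'I_m -> uprod_carrier H) :
    env_at n (tup_env None a) = tup_env None (fun j => a j n).
  by apply: funext => -[//|j]; rewrite /env_at /=; case: insub.
split=> [a|a i]; last first.
  rewrite (los ultraU H_gt0); split=> h;
    apply: (ultra_mono ultraU) ((ultra_and ultraU _ _).2 (conj good h)) => n [gn];
    rewrite env_tup.
    by have [_ /(_ i)[]] := gn (fun j => a j n).
  by have [_ /(_ i)[_]] := gn (fun j => a j n).
(* The index found in [H n] varies with [n]; as there are finitely many, a single one works on a set
   in [U]. *)
have [|i Ui] := @ultra_exists U ultraU 'I_k
    (fun i n => gsat (env_at n (tup_env None a)) (psi i)).
  apply: (ultra_mono ultraU) good => n /(_ (fun j => a j n))[[i0 hi0] _].
  by exists i0; rewrite env_tup; apply/hi0.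
exists i; split=> [|j]; first exact/(los ultraU H_gt0).
rewrite (los ultraU H_gt0) => Uj; apply: contrapT => ne.
have : U (fun _ => False); last by case: ultraU.
(* If [i] and [j] differed, both formulas would hold in some [H n] where exactly one index is
   possible. *)
have /(ultra_and ultraU _ _) UU := conj good ((ultra_and ultraU _ _).2 (conj Ui Uj)).
apply: (ultra_mono ultraU) UU => n [gn []]; rewrite env_tup.
have [[i0 hi0] _] := gn (fun j => a j n).
by move=> /hi0 ei /hi0 ej; apply: ne; rewrite ei ej.
Qed.
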